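(* Let $f,g:\mathbb{R}^{N}\rightarrow \mathbb{R}$ be quasiconvex functions such that $f=g$ almost everywhere, so that $\operatorname{ess\,inf}_{\mathbb{R}^{N}}f=\operatorname{ess\,inf}_{\mathbb{R}^{N}}g=:m$ (with $m\geq -\infty$). For $\alpha\in\mathbb{R}$ let $F_{\alpha}:=\{y\in\mathbb{R}^N: f(y)<\alpha\}$, and similarly $F_m:=\{y\in\mathbb{R}^N:f(y)<m\}$. (i) If $x\in \mathbb{R}^{N}$ is a point of approximate continuity of $g$, then $g(x)\geq m$. Furthermore, a point $x$ of approximate continuity of $g$ is not a point of approximate continuity of $f$ if and only if $m>-\infty$, $g(x)=m$ and $x\in F_{m}$. The set $F_m$ has measure $0$. (ii) If $x\in \mathbb{R}^{N}$ is a point of continuity of $g$, then $g(x)\geq m$. Furthermore, a point $x$ of continuity of $g$ is not a point of continuity of $f$ if and only if $m>-\infty$, $g(x)=m$ and $x\in \bigcup_{\alpha <m}\overline{F}_{\alpha }$ (union over real $\alpha<m$). Moreover $\bigcup_{\alpha <m}\overline{F}_{\alpha }\subset \overline{F}_{m}$, and $\overline{F}_m$ has measure $0$.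
   Context: A function $f:\mathbb{R}^N\to\mathbb{R}$ is quasiconvex if $\{x\in\mathbb{R}^N: f(x)<\alpha\}$ is convex for every $\alpha\in\mathbb{R}$; such functions are automatically Lebesgue measurable. Measure, ''almost everywhere'' and $\operatorname{ess\,inf}$ refer to Lebesgue measure $\mu_N$ on $\mathbb{R}^N$. Continuity and closures $\overline{F}$ refer to the euclidean topology. A measurable set $E$ has density $1$ at $x$ if $\mu_N(E\cap B(x,r))/\mu_N(B(x,r))\to 1$ as $r\to 0^+$, where $B(x,r)$ is the open euclidean ball. The density topology on $\mathbb{R}^N$ is the topology whose open sets (density open sets) are $\emptyset$ and the measurable sets having density $1$ at each of their points. A point $x$ is a point of approximate continuity of a function $h:\mathbb{R}^N\to\mathbb{R}$ if $h$ is continuous at $x$ when $\mathbb{R}^N$ carries the density topology and $\mathbb{R}$ the euclidean topology; for measurable $h$ this means that $h^{-1}(V)$ has density $1$ at $x$ for every open $V\subset\mathbb{R}$ containing $h(x)$. *)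

(* Defs.v *)
From HB Require Import structures.
From mathcomp Require Import all_boot all_order all_algebra.
From mathcomp Require Import all_classical all_reals all_analysis.

Set Implicit Arguments.
Unset Strict Implicit.
Unset Printing Implicit Defensive.
Import Order.TTheory GRing.Theory Num.Theory.
Import numFieldNormedType.Exports.
Local Open Scope classical_set_scope.
Local Open Scope ring_scope.

(* R^N is 'rV[R]_N; its library topology (product topology, sup norm) is the
   euclidean topology. *)

Section lebesgue.
Local Open Scope ereal_scope.
Context {R : realType} {N : nat}.
Local Notation E := 'rV[R]_N.

(* Some (a, b) denotes the open box \prod_i ]a_i, b_i[; None denotes the empty
   set, which is not a box when N = 0. *)
Definition cell (B : option (E * E)) : set E :=
  if B is Some (a, b) then
    [set x | forall i, (a ord0 i < x ord0 i < b ord0 i)%R]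
  else set0.

Definition cell_volume (B : option (E * E)) : \bar R :=
  if B is Some (a, b) then
    (\prod_(i < N) Num.max 0 (b ord0 i - a ord0 i))%R%:E
  else 0.

Definition cell_cover (A : set E) : set (nat -> option (E * E)) :=
  [set B | A `<=` \bigcup_k cell (B k)].

Definition lebesgue_outer (A : set E) : \bar R :=
  ereal_inf [set \sum_(k <oo) cell_volume (B k) | B in cell_cover A].

Lemma cell_volume_ge0 B : 0 <= cell_volume B.
Proof.
case: B => [[a b]|//]; rewrite lee_fin.
by apply: prodr_ge0 => i _; rewrite le_max lexx.
Qed.

Lemma lebesgue_outer_ge0 A : 0 <= lebesgue_outer A.
Proof.
apply: le_ereal_inf_tmp => _ [B _ <-].
by apply: nneseries_ge0 => k _ _; exact: cell_volume_ge0.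
Qed.

Lemma lebesgue_outer0 : lebesgue_outer set0 = 0.
Proof.
apply/eqP; rewrite eq_le lebesgue_outer_ge0 andbT.
apply: ereal_inf_lbound; exists (fun=> None); first exact: sub0set.
exact: eseries0.
Qed.

Lemma le_lebesgue_outer :
  {homo lebesgue_outer : A B / A `<=` B >-> A <= B}.
Proof.
move=> A B AB; apply/ereal_inf_le_tmp => _ [C BC <-]; exists C => //.
exact: subset_trans AB BC.
Qed.

Lemma lebesgue_outer_sigma_subadditive :
  sigma_subadditive lebesgue_outer.
Proof.
move=> A; have [[i ioo]|] := pselect (exists i, lebesgue_outer (A i) = +oo).
  rewrite (eseries_pinfty _ _ ioo) ?leey// => n _.
  by rewrite -ltNye (lt_le_trans _ (lebesgue_outer_ge0 _)).
rewrite -forallNE => Aoo; apply/lee_addgt0Pr => _/posnumP[e].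
rewrite (le_trans _ (epsilon_trick _ _ _))//; last first.
  by move=> n; exact: lebesgue_outer_ge0.
pose P n B := cell_cover (A n) B /\
  \sum_(k <oo) cell_volume (B k) <=
    lebesgue_outer (A n) + (e%:num / (2 ^ n.+1)%:R)%:E.
have [G PG] : {G : nat -> nat -> option (E * E) & forall n, P n (G n)}.
  apply: (@choice _ _ P) => n.
  have en1 : (0 < e%:num / (2 ^ n.+1)%:R :> R)%R by [].
  have fA : lebesgue_outer (A n) \is a fin_num.
    rewrite fin_numE; apply/andP; split; last exact/eqP/Aoo.
    by rewrite gt_eqF// (lt_le_trans _ (lebesgue_outer_ge0 _)).
  have [_ [B AB <-] xS] := lb_ereal_inf_adherent en1 fA.
  by exists B; split => //; exact/ltW.
pose v (ij : nat * nat) := cell_volume (G ij.1 ij.2).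
have v_ge0 ij : 0 <= v ij by exact: cell_volume_ge0.
apply: (@le_trans _ _ (\esum_(ij in setT) v ij)).
  apply: ereal_inf_lbound => /=.
  have /card_esym/ppcard_eqP[f] := card_nat2.
  exists (fun k => G (f k).1 (f k).2).
    move=> t [i _] /(PG i).1 [j _ ijt]; exists (f^-1%FUN (i, j)) => //=.
    by rewrite invK ?inE.
  rewrite (reindex_esum setT setT f)//.
  by rewrite nneseries_esumT// => k; exact: cell_volume_ge0.
rewrite (_ : esum _ _ = \sum_(i <oo) \sum_(j <oo) v (i, j)); last first.
  transitivity (\esum_(i in setT) \esum_(j in setT) v (i, j)).
    rewrite esum_esum//; congr esum.
    by apply/seteqP; split.
  rewrite nneseries_esumT; last first.
    by move=> k; apply: nneseries_ge0 => *; exact: v_ge0.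
  by apply: eq_esum => i _; rewrite nneseries_esumT.
apply: lee_nneseries => [n _ _|n _].
  by apply: nneseries_ge0 => *; exact: v_ge0.
exact: (PG n).2.
Qed.

HB.instance Definition _ := isOuterMeasure.Build R E lebesgue_outer
  lebesgue_outer0 lebesgue_outer_ge0 le_lebesgue_outer
  lebesgue_outer_sigma_subadditive.

End lebesgue.

(* R^N with the sigma-algebra of Lebesgue measurable sets, i.e., the
   Caratheodory measurable sets of the Lebesgue outer measure. *)
Definition lebesgue_rV (R : realType) (N : nat) : Type :=
  caratheodory_type (@lebesgue_outer R N).
HB.instance Definition _ R N := Measurable.on (lebesgue_rV R N).

(* As a function of arbitrary sets this is the outer measure; it vanishes exactly
   on the Lebesgue null sets, which are all measurable (completeness). *)
Definition lebesgue_measure_rV {R : realType} {N : nat} :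
    set (lebesgue_rV R N) -> \bar R :=
  @lebesgue_outer R N.

HB.instance Definition _ R N := isMeasure.Build _ _ _ (@lebesgue_measure_rV R N)
  (@caratheodory_measure0 R _ (@lebesgue_outer R N))
  (@caratheodory_measure_ge0 R _ (@lebesgue_outer R N))
  (@caratheodory_measure_sigma_additive R _ (@lebesgue_outer R N)).

Section density.
Context {R : realType} {N : nat}.
Local Notation E := 'rV[R]_N.

Definition quasiconvex (f : E -> R) :=
  forall a : R, @convex_set R E [set x | f x < a].

Definition euclidean_ball (x : E) (r : R) : set E :=
  [set y | Num.sqrt (\sum_(i < N) (y ord0 i - x ord0 i) ^+ 2) < r].

Definition density_one (A : set E) (x : E) :=
  (lebesgue_measure_rV (A `&` euclidean_ball x r)
    * (lebesgue_measure_rV (euclidean_ball x r))^-1)%E @[r --> 0^'+] --> 1%E.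

Definition density_open (A : set (lebesgue_rV R N)) :=
  measurable A /\ forall x, A x -> density_one A x.

(* Neighborhoods of x for the density topology. That the density open sets form
   a topology (a consequence of the Lebesgue density theorem) is not needed to
   define continuity at a point. *)
Definition density_nbhs (x : E) : set_system E :=
  [set A | exists U : set E, [/\ density_open U, U x & U `<=` A]].

Definition approx_continuous_at (x : E) (h : E -> R) :=
  h @ density_nbhs x --> h x.

End density.

(* Main.v *)
Require Import Defs.
From mathcomp Require Import all_boot all_order all_algebra.
From mathcomp Require Import all_classical all_reals all_analysis.
From mathcomp Require Import ess_sup_inf.
From mathcomp Require Import measurable_realfun ring lra.
Set Implicit Arguments.
Unset Strict Implicit.
Unset Printing Implicit Defensive.

Import Order.TTheory GRing.Theory Num.Theory.
Import numFieldNormedType.Exports.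
Local Open Scope classical_set_scope.
Local Open Scope ring_scope.

(** Write F_a = {f < a} and G_a = {g < a}: convex sets that differ by a null set.

    Convex sets interact with null sets and with density through a single
    elementary fact ([convex_corners]): a convex set that has a point strictly
    inside each of the 2^N orthants with vertex x contains x, and even a
    neighborhood of x. Consequently
    - int F_a = int G_a, because around a point of int G_a every small ball
      has positive measure, hence meets F_a ([ae_eq_convex_nbhs]);
    - a convex set that contains a set of density one at x is a neighborhood of
      x ([density_one_interior]);
    - a convex set and its closure have the same interior
      ([convex_nbhs_closure]).

    A convex set C with nonempty interior moreover contains, near each point x
    of its closure, small copies of one of its balls under homotheties of
    centre x ([convex_cone]). Hence closure C = closure (int C), and sets of
    density one at x meet C ([density_one_closure]). Finally, a convex set
    without interior has a null closure ([convex_nonnull_ball]).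

    Let now g be approximately continuous at x. For a > g x the set G_a contains
    a set of density one at x, so x is interior to G_a and to F_a; this is
    impossible when a <= m since F_a is then null, whence g x >= m, and in any
    case f is upper semicontinuous at x with respect to the value g x. For
    m < b < g x the complement of G_b has density one at x, so x is not in the
    closure of G_b; but int F_b = int G_b is not empty, so that F_b and G_b have
    the same closure, and f >= b near x. If m < g x, then both facts together show
    that f is continuous at x ([continuous_of_lt]). If g x = m, then only the sets
    F_b with b < m, all contained in the null set F_m, can spoil the lower
    estimate: f is approximately continuous at x as soon as x is not in F_m
    ([approx_continuous_of_eq]), and continuous at x as soon as x is in none of
    the closures of the F_b ([continuous_of_eq]). Conversely, if f is
    approximately continuous at x, then f x >= m by the same argument as for g.

    The measure theory is kept at the level of boxes: the outer measure of a box
    is its volume ([lebesgue_outer_cell]), and open sets are measurable. *)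

(** * The outer measure of a box *)

(** Integrating over ]a, b[ a bound that holds at each of its points: the step
    that integrates out one coordinate in the computation of the measure of a
    box. *)
Lemma series_interval_integral_le (R : realType) (c p q : nat -> R) (K a b : R) :
  (forall k, 0 <= c k) -> a <= b ->
  (forall t, a < t < b ->
    (K%:E <= \sum_(k <oo) (c k * (p k < t < q k)%R%:R)%:E)%E) ->
  ((K * (b - a))%:E <= \sum_(k <oo) (c k * Num.max 0 (q k - p k))%:E)%E.
Proof.
move=> c0 ab H.
set D : set (measurableTypeR R) := `]a, b[%classic.
have mD : measurable D by exact: measurable_itv.
set h := fun k (t : measurableTypeR R) => (c k * (p k < t < q k)%R%:R)%:E.
have hE k : h k = (fun t => ((c k)%:E * (\1_(`]p k, q k[%classic) t)%:E)%E).
  apply/funext => t; rewrite /h -EFinM indicE; congr (_ * (nat_of_bool _)%:R)%:E.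
  by apply/idP/idP; rewrite inE/= in_itv.
have h0 k t : (0 <= h k t)%E.
  by rewrite lee_fin mulr_ge0.
have mh k (E : set (measurableTypeR R)) : measurable_fun E (h k).
  rewrite hE; apply: measurable_funeM; apply/measurable_EFinP.
  by apply: (measurable_funS measurableT) => //; exact: measurable_indic.
apply: (@le_trans _ _ (\int[@lebesgue_measure R]_(t in D) K%:E)%E).
  rewrite integral_cst//= /D lebesgue_measure_itv/= lte_fin.
  move: ab; rewrite le_eqVlt => /predU1P[->|->].
    by rewrite ltxx subrr mulr0 mule0.
  by rewrite EFinM.
apply: (@le_trans _ _ (\int[@lebesgue_measure R]_(t in D)
    (\sum_(k <oo) h k t))%E).
  have [K0|K0] := leP 0 K.
    apply: ge0_le_integral => //.
    by apply: ge0_emeasurable_sum => // k *.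
  apply: (@le_trans _ _ 0%E).
    rewrite integral_cst//=.
    by rewrite mule_le0_ge0// lee_fin ltW.
  by apply: integral_ge0 => t _; apply: nneseries_ge0.
rewrite integral_nneseries//.
apply: lee_nneseries => [k _ _|k _].
  exact: integral_ge0.
rewrite hE ge0_integralZl//; last 2 first.
- apply/measurable_EFinP; apply: (measurable_funS measurableT) => //.
- exact: c0.
rewrite EFinM lee_wpmul2l ?lee_fin//.
rewrite integral_indic//= (le_trans (le_measure _ _ _ (@subIsetl _ _ _)))//=.
- by rewrite inE; apply: measurableI; exact: measurable_itv.
- by rewrite inE; exact: measurable_itv.
rewrite lebesgue_measure_itv/= lte_fin; case: ltP => pq.
  by rewrite lee_fin le_max lexx orbT.
by rewrite lee_fin le_max lexx.
Qed.

Section cells.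
Context {R : realType} {N : nat}.
Local Notation E := 'rV[R]_N.
Implicit Types (a b x v : E) (B : option (E * E)) (A : set E).

Lemma lebesgue_outer_cell_le B : (lebesgue_outer (cell B) <= cell_volume B)%E.
Proof.
pose B_ (k : nat) : option (E * E) := if k is 0%N then B else None.
apply: ereal_inf_lbound; exists B_; first by move=> x Bx; exists 0%N.
rewrite nneseries_recl//; last by move=> *; exact: cell_volume_ge0.
by rewrite eseries_cond/= eseries0 ?adde0// => -[|].
Qed.

Definition upd_coord x (j : 'I_N) (t : R) : E :=
  \row_i (if i == j then t else x ord0 i).

(** The indicator function of the box, integrated over its first [j]
    coordinates. *)
Let mixed (j : nat) x B : R :=
  if B is Some (a, b) then
    \prod_(i < N) (if (i < j)%N then Num.max 0 (b ord0 i - a ord0 i)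
      else (a ord0 i < x ord0 i < b ord0 i)%R%:R)
  else 0.

(** The indicator functions of the boxes of a cover sum up to at least 1 on the
    covered box; the claim follows by integrating this inequality over the
    covered box, one coordinate after the other. *)
Lemma cell_volume_le B : (cell_volume B <= lebesgue_outer (cell B))%E.
Proof.
case: B => [[a b]|]; last exact: lebesgue_outer_ge0.
have [/forallP/= ab|] := boolP [forall i, a ord0 i < b ord0 i]; last first.
  rewrite negb_forall => /existsP[i]; rewrite -leNgt => ba.
  rewrite /cell_volume (bigD1 i)//= max_l ?subr_le0// mul0r.
  exact: lebesgue_outer_ge0.
apply: le_ereal_inf_tmp => _ [B BC <-].
have mixed_ge0 j x k : 0 <= mixed j x (B k).
  rewrite /mixed; case: (B k) => [[p q]|//]; apply: prodr_ge0 => i _.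
  by case: ifP => _; rewrite ?le_max ?lexx.
suff H (j : nat) : (j <= N)%N -> forall x, cell (Some (a, b)) x ->
    ((\prod_(i < N) (if (i < j)%N then b ord0 i - a ord0 i else 1))%:E <=
     \sum_(k <oo) (mixed j x (B k))%:E)%E.
  have xab : cell (Some (a, b)) (\row_i ((a ord0 i + b ord0 i) / 2)).
    by move=> i; rewrite mxE !midf_lt.
  have {H} := H N (leqnn _) _ xab.
  congr (_ <= _)%E.
    congr (_%:E); apply: eq_bigr => i _.
    by rewrite ltn_ord max_r// subr_ge0 ltW.
  apply: eq_eseriesr => k _; rewrite /mixed; case: (B k) => [[p q]|//].
  by congr (_%:E); apply: eq_bigr => i _; rewrite ltn_ord.
elim: j => [_ x xab|j IH jN x xab].
  rewrite big1//; have [k _ xB] := BC _ xab.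
  apply: (@le_trans _ _ (mixed 0 x (B k))%:E).
    move: xB; rewrite /mixed; case: (B k) => [[p q]|//] xB.
    by rewrite big1// => i _; rewrite xB.
  rewrite (@nneseriesD1 _ _ k)//; last by move=> *; rewrite lee_fin.
  by rewrite leeDl// nneseries_ge0// => *; rewrite lee_fin.
pose jj := Ordinal jN.
have Npred (i : 'I_N) : i != jj -> (i < j.+1)%N = (i < j)%N.
  move=> ij; rewrite ltnS leq_eqVlt -(inj_eq val_inj)/= in ij *.
  by rewrite (negbTE ij).
pose c k := if B k is Some (p, q) then
   \prod_(i < N | i != jj) (if (i < j)%N then Num.max 0 (q ord0 i - p ord0 i)
      else (p ord0 i < x ord0 i < q ord0 i)%R%:R) else 0.
pose p k := if B k is Some (p, q) then p ord0 jj else 0.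
pose q k := if B k is Some (p, q) then q ord0 jj else 0.
have c0 k : 0 <= c k.
  rewrite /c; case: (B k) => [[u v]|//]; apply: prodr_ge0 => i _.
  by case: ifP => _; rewrite ?le_max ?lexx.
rewrite (bigD1 jj)//= ltnSn mulrC.
have -> : (\sum_(k <oo) (mixed j.+1 x (B k))%:E =
          \sum_(k <oo) (c k * Num.max 0 (q k - p k))%:E)%E.
  apply: eq_eseriesr => k _; rewrite /mixed /c /p /q.
  case: (B k) => [[u v]|]; last by rewrite mul0r.
  rewrite (bigD1 jj)//= ltnSn mulrC; congr (_ * _)%:E.
  by apply: eq_bigr => i /Npred ->.
apply: series_interval_integral_le => //; first by rewrite ltW.
move=> t abt.
have updab : cell (Some (a, b)) (upd_coord x jj t).
  by move=> i; rewrite mxE; case: eqP => [->//|_]; exact: xab.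
rewrite (eq_bigr (fun i : 'I_N =>
    if (i < j)%N then b ord0 i - a ord0 i else 1)); last by move=> i /Npred ->.
have := IH (ltnW jN) _ updab.
rewrite (bigD1 jj)//= ltnn mul1r => /le_trans; apply.
apply: lee_nneseries => [k _ _|k _]; first by rewrite lee_fin.
rewrite /mixed /c /p /q; case: (B k) => [[u v]|]; last by rewrite mul0r.
rewrite (bigD1 jj)//= ltnn mulrC mxE eqxx lee_fin.
rewrite le_eqVlt; apply/orP; left; apply/eqP; congr (_ * _).
by apply: eq_bigr => i ij; rewrite mxE (negbTE ij).
Qed.

Lemma lebesgue_outer_cell B : lebesgue_outer (cell B) = cell_volume B.
Proof.
by apply/le_anti; rewrite lebesgue_outer_cell_le cell_volume_le.
Qed.

End cells.

(** * Measurability of open sets and invariance under translations *)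

Section measurability.
Context {R : realType} {N : nat}.
Local Notation E := 'rV[R]_N.
Local Notation mu := (@lebesgue_measure_rV R N).
Implicit Types (a b x v : E) (B : option (E * E)) (A : set E).

Lemma cell_volume_upd a b (i : 'I_N) (s t : R) :
  cell_volume (Some (upd_coord a i s, upd_coord b i t)) =
  (Num.max 0 (t - s) *
   \prod_(j < N | j != i) Num.max 0 (b ord0 j - a ord0 j))%:E.
Proof.
rewrite /cell_volume (bigD1 i)//= !mxE eqxx; congr (_ * _)%:E.
by apply: eq_bigr => j ji; rewrite !mxE (negbTE ji).
Qed.

Lemma upd_coordE a (i : 'I_N) : upd_coord a i (a ord0 i) = a.
Proof. by apply/rowP => j; rewrite mxE; case: eqP => [->|]. Qed.

(** The piece of hyperplane lies in slabs of arbitrarily small thickness [2 d]. *)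
Lemma outer_cell_hyperplane B (i : 'I_N) (c : R) :
  lebesgue_outer (cell B `&` [set x : E | x ord0 i = c]) = 0%E.
Proof.
case: B => [[a b]|]; last by rewrite set0I outer_measure0.
apply/le_anti; rewrite outer_measure_ge0 andbT.
apply/lee_addgt0Pr => e e0; rewrite add0e.
pose K := \prod_(j < N | j != i) Num.max 0 (b ord0 j - a ord0 j).
have K0 : 0 <= K by apply: prodr_ge0 => j _; rewrite le_max lexx.
pose d := e / (K + 1) / 2.
have d0 : 0 < d by rewrite !divr_gt0// ltr_wpDl.
have sub : cell (Some (a, b)) `&` [set x : E | x ord0 i = c] `<=`
    cell (Some (upd_coord a i (c - d), upd_coord b i (c + d))).
  move=> x [xab xc] j; rewrite !mxE; case: eqP => [->|_]; last exact: xab.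
  by rewrite xc ltrBlDr !ltrDl d0.
rewrite (le_trans (le_lebesgue_outer sub))// lebesgue_outer_cell.
rewrite cell_volume_upd lee_fin -/K max_r; last by lra.
have -> : c + d - (c - d) = e / (K + 1) by rewrite /d; lra.
by rewrite mulrAC ler_pdivrMr ?ltr_wpDl// ler_pM2l//; lra.
Qed.

(** A hyperplane cuts each box of a cover into two boxes whose volumes add up; what
    remains is contained in the hyperplane and negligible, so that both the
    open and the closed half-space are covered. *)
Lemma halfspace_caratheodory (i : 'I_N) (c : R) (H : set E) :
  [set x : E | x ord0 i < c] `<=` H -> H `<=` [set x : E | x ord0 i <= c] ->
  (@lebesgue_outer R N).-caratheodory H.
Proof.
move=> ltH Hle; apply: le_caratheodory_measurable => X.
apply: le_ereal_inf_tmp => _ [B XB <-].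
pose s A := (\sum_(k <oo) lebesgue_outer (cell (B k) `&` A))%E.
have sX A : (lebesgue_outer (X `&` A) <= s A)%E.
  apply: (le_trans (y := lebesgue_outer (\bigcup_k (cell (B k) `&` A)))).
    by apply: le_lebesgue_outer => x [/XB[k _ kx] Ax]; exists k.
  exact: lebesgue_outer_sigma_subadditive.
apply: le_trans (leeD (sX H) (sX (~` H))) _.
have outer_ge0 A : (0 <= lebesgue_outer A)%E by exact: lebesgue_outer_ge0.
rewrite /s -nneseriesD//.
apply: lee_nneseries => [k _ _|k _]; first exact: adde_ge0.
have cut A A' : A `<=` [set x : E | x ord0 i = c] `|` A' ->
    (lebesgue_outer (cell (B k) `&` A) <= lebesgue_outer (cell (B k) `&` A'))%E.
  move=> AA'.
  have sub : cell (B k) `&` A `<=`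
      (cell (B k) `&` [set x : E | x ord0 i = c]) `|` (cell (B k) `&` A').
    by move=> x [kx /AA'[]]; [left|right].
  rewrite (le_trans (le_lebesgue_outer sub))//.
  rewrite (le_trans (outer_measureU2 (@lebesgue_outer R N) _ _))//=.
  by rewrite outer_cell_hyperplane add0e.
pose L : set E := [set x | x ord0 i < c].
pose G : set E := [set x | c < x ord0 i].
apply: (@le_trans _ _ (lebesgue_outer (cell (B k) `&` L) +
                       lebesgue_outer (cell (B k) `&` G))%E).
  apply: leeD; apply: cut => x.
    by move=> /Hle/=; rewrite le_eqVlt => /predU1P[]; [left|right].
  move=> /= Hx; case: (ltgtP (x ord0 i) c) => [xc|xc|xc]; [|by right|by left].
  by case: Hx; exact: ltH.
case: (B k) => [[a b]|]; last by rewrite !set0I !outer_measure0 adde0.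
have -> : cell (Some (a, b)) `&` L =
    cell (Some (a, upd_coord b i (Num.min (b ord0 i) c))).
  apply/seteqP; split => [x [xab xc] j|x xab].
    rewrite mxE; case: eqP => [->|_]; last exact: xab.
    by rewrite lt_min xc andbT.
  split => [j|]; last first.
    by have := xab i; rewrite mxE eqxx lt_min => /and3P[].
  have := xab j; rewrite mxE; case: eqP => // ->.
  by rewrite lt_min => /and3P[-> ->].
have -> : cell (Some (a, b)) `&` G =
    cell (Some (upd_coord a i (Num.max (a ord0 i) c), b)).
  apply/seteqP; split => [x [xab xc] j|x xab].
    rewrite mxE; case: eqP => [->|_]; last exact: xab.
    by rewrite gt_max xc andbT.
  split => [j|]; last first.
    by have := xab i; rewrite mxE eqxx gt_max => /andP[/andP[]].
  have := xab j; rewrite mxE; case: eqP => // ->.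
  by rewrite gt_max => /andP[/andP[-> _] ->].
rewrite !lebesgue_outer_cell.
pose K := \prod_(j < N | j != i) Num.max 0 (b ord0 j - a ord0 j).
have Vb t : cell_volume (Some (a, upd_coord b i t)) =
    (Num.max 0 (t - a ord0 i) * K)%:E.
  by rewrite -[X in Some (X, _)](upd_coordE a i); exact: cell_volume_upd.
have Va t : cell_volume (Some (upd_coord a i t, b)) =
    (Num.max 0 (b ord0 i - t) * K)%:E.
  by rewrite -[X in Some (_, X)](upd_coordE b i); exact: cell_volume_upd.
have Vab : cell_volume (Some (a, b)) =
    (Num.max 0 (b ord0 i - a ord0 i) * K)%:E.
  by rewrite -[X in Some (X, _)](upd_coordE a i); exact: Va.
rewrite Vb Va Vab -EFinD lee_fin -mulrDl ler_wpM2r//.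
  by apply: prodr_ge0 => j _; rewrite le_max lexx.
rewrite /Num.min /Num.max.
by repeat case: ifPn; rewrite -?leNgt => *; lra.
Qed.

Lemma measurable_cell B : measurable (cell B : set (lebesgue_rV R N)).
Proof.
case: B => [[a b]|]; last exact: measurable0.
have -> : cell (Some (a, b)) = \bigcap_(i in [set: 'I_N])
    ([set x : lebesgue_rV R N | (x : E) ord0 i < b ord0 i] `\`
     [set x : lebesgue_rV R N | (x : E) ord0 i <= a ord0 i]).
  apply/seteqP; split => [x xab i _|x xab i].
    have /andP[ax xb] := xab i.
    by split => //=; apply/negP; rewrite -ltNge.
  by have [/= -> /negP] := xab i I; rewrite -ltNge => ->.
apply: fin_bigcap_measurable => // i _.
apply: measurableD.
  by apply: (@halfspace_caratheodory i (b ord0 i)) => // x /ltW.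
by apply: (@halfspace_caratheodory i (a ord0 i)) => // x /ltW.
Qed.

End measurability.

Section balls.
Context {R : realType} {N : nat}.
Local Notation E := 'rV[R]_N.
Local Notation mu := (@lebesgue_measure_rV R N).
Implicit Types (a b x v : E) (B : option (E * E)) (A : set E) (e : R).

Lemma rV_ballP x e y : 0 < e ->
  ball x e y <-> forall i, `|x ord0 i - y ord0 i| < e.
Proof.
move=> e0; split => [[_ h] i|h]; first exact: h.
by split => // i j; rewrite ord1; exact: h.
Qed.

Lemma ball_cell x e : 0 < e ->
  ball x e = cell (Some (x - const_mx e, x + const_mx e)).
Proof.
move=> e0; apply/seteqP; split => y.
  by move/(rV_ballP _ _ e0) => h i; have := h i; rewrite !mxE ltr_norml; lra.
by move=> h; apply/rV_ballP => // i; have := h i; rewrite !mxE ltr_norml; lra.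
Qed.

Lemma measurable_null A : mu A = 0%E -> measurable (A : set (lebesgue_rV R N)).
Proof.
move=> A0; apply: le_caratheodory_measurable => X.
have XA0 : lebesgue_outer (X `&` A) = 0%E.
  apply/le_anti; rewrite lebesgue_outer_ge0 andbT -A0.
  by apply: le_lebesgue_outer; exact: subIsetr.
by rewrite /= XA0 add0e; apply: le_lebesgue_outer; exact: subIsetl.
Qed.

Lemma lebesgue_ball x e : 0 < e -> mu (ball x e) = ((2 * e) ^+ N)%:E.
Proof.
move=> e0; rewrite /lebesgue_measure_rV ball_cell// lebesgue_outer_cell/=.
congr (_%:E); rewrite (eq_bigr (fun=> 2 * e)) ?prodr_const ?card_ord// => i _.
by rewrite !mxE max_r; lra.
Qed.

Lemma lebesgue_ball_gt0 x e : 0 < e -> (0 < mu (ball x e))%E.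
Proof. by move=> e0; rewrite lebesgue_ball// lte_fin exprn_gt0// mulr_gt0. Qed.

Lemma measurable_ball_rV x e : 0 < e ->
  measurable (ball x e : set (lebesgue_rV R N)).
Proof. by move=> e0; rewrite ball_cell//; exact: measurable_cell. Qed.

Lemma measurable_open_rV A : open A -> measurable (A : set (lebesgue_rV R N)).
Proof.
move=> oA.
pose c (q : 'rV[rat]_N) : E := map_mx ratr q.
pose D := [set p : 'rV[rat]_N * 'rV[rat]_N |
  cell (Some (c p.1, c p.2)) `<=` A].
have -> : A = \bigcup_(p in D) cell (Some (c p.1, c p.2)).
  apply/seteqP; split => [x Ax|x [p /=]]; last by move=> + xp; apply.
  have /nbhs_ballP[e /= e0 eA] : nbhs x A by exact: open_nbhs_nbhs.
  have /choice[p Hp] (i : 'I_N) : exists q : rat,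
      x ord0 i - e < ratr q < x ord0 i.
    have xe : x ord0 i - e < x ord0 i by lra.
    by have [q] := rat_in_itvoo xe; rewrite in_itv/=; exists q.
  have /choice[q Hq] (i : 'I_N) : exists q : rat,
      x ord0 i < ratr q < x ord0 i + e.
    have xe : x ord0 i < x ord0 i + e by lra.
    by have [q] := rat_in_itvoo xe; rewrite in_itv/=; exists q.
  exists (\row_i p i, \row_i q i) => /=.
    move=> y xy; apply: eA; apply/rV_ballP => // i.
    have := xy i; have := Hp i; have := Hq i; rewrite !mxE ltr_norml; lra.
  by move=> i; rewrite !mxE; have /andP[_ ->] := Hp i; have /andP[-> _] := Hq i.
rewrite bigcup_mkcond; apply: countable_bigcupT_measurable => // p.
by case: ifP => _; [exact: measurable_cell|exact: measurable0].
Qed.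

Lemma measurable_closed_rV A :
  closed A -> measurable (A : set (lebesgue_rV R N)).
Proof.
move=> cA; rewrite -[A]setCK.
exact/measurableC/measurable_open_rV/closed_openC.
Qed.

(** Translating a cover by boxes yields a cover of the same total volume. *)
Lemma lebesgue_translate_le A v :
  (mu [set (x + v)%R | x in A] <= mu A)%E.
Proof.
apply: le_ereal_inf_tmp => _ [B AB <-].
pose B' k := if B k is Some (a, b) then Some (a + v, b + v) else None.
apply: ereal_inf_lbound; exists B'.
  move=> _ [x /AB[k _ xk] <-]; exists k => //.
  move: xk; rewrite /B'; case: (B k) => [[a b]|//] xab i.
  by rewrite !mxE !ltrD2r.
apply: eq_eseriesr => k _; rewrite /B'; case: (B k) => [[a b]|//].
congr (_%:E); apply: eq_bigr => i _; rewrite !mxE; congr Num.max; lra.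
Qed.

Lemma lebesgue_translate A v : mu [set x + v | x in A]%R = mu A.
Proof.
apply/le_anti; rewrite lebesgue_translate_le/=.
have AvK : [set x - v | x in [set x + v | x in A]] = A.
  apply/seteqP; split => [_ [_ [x Ax <-] <-]|x Ax]; first by rewrite addrK.
  by exists (x + v); [exists x|rewrite addrK].
by rewrite -{1}AvK; exact: lebesgue_translate_le.
Qed.

Lemma measurable_translate A v : measurable (A : set (lebesgue_rV R N)) ->
  measurable ([set x + v | x in A] : set (lebesgue_rV R N)).
Proof.
move=> mA; apply: le_caratheodory_measurable => X.
pose T u : set E -> set E := fun Y => [set x + u | x in Y].
have TK Y : T v (T (- v) Y) = Y.
  apply/seteqP; split => [_ [_ [x Yx <-] <-]|x Yx]; first by rewrite subrK.
  by exists (x - v); [exists x|rewrite subrK].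
have muT Y : lebesgue_outer (T v Y) = lebesgue_outer Y.
  exact: lebesgue_translate.
have shiftI Z : lebesgue_outer (X `&` T v Z) = lebesgue_outer (T (- v) X `&` Z).
  rewrite -(muT (_ `&` Z)); congr (lebesgue_outer _).
  apply/seteqP; split => [x [Xx [z Zz zx]]|].
    by exists z => //; split => //; exists x => //; rewrite -zx addrK.
  move=> _ [z [[x Xx xz] Zz] <-]; split; last by exists z.
  by rewrite -xz subrK.
have -> : ~` [set x + v | x in A] = T v (~` A).
  apply/seteqP; split => [x nx|_ [z nz <-] [y Ay /addIr yz]].
    by exists (x - v); [move=> Ax; apply: nx; exists (x - v) => //|];
      rewrite subrK.
  by apply: nz; rewrite -yz.
rewrite /= !shiftI.
have <- : lebesgue_outer (T (- v) X) = lebesgue_outer X by rewrite -muT TK.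
by have /= <- := mA (T (- v) X).
Qed.

End balls.

(** * Interior and closure of convex sets *)

Section convex.
Context {R : realType} {N : nat}.
Local Notation E := 'rV[R]_N.
Local Notation mu := (@lebesgue_measure_rV R N).
Local Notation convex := (@convex_set R E).
Implicit Types (x y v : E) (C : set E) (e d r t : R).

Lemma convex_setP C : convex C <->
  forall x y t, C x -> C y -> 0 <= t <= 1 -> C (t *: x + (1 - t) *: y).
Proof.
split => [cC x y t Cx Cy /andP[t0 t1]|cC x y t].
  have := cC x y (Itv01 t0 t1); rewrite !inE => /(_ Cx Cy).
  by [].
rewrite !inE => Cx Cy; apply: cC => //.
by rewrite ge0 le1.
Qed.

Let conv_gt t (u w c : R) :
  0 <= t <= 1 -> c < u -> c < w -> c < t * u + (1 - t) * w.
Proof.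
move=> /andP[]; rewrite le_eqVlt => /predU1P[<- _|t0 t1] cu cw.
  by rewrite mul0r add0r subr0 mul1r.
have : 0 < t * (u - c) by rewrite mulr_gt0 ?subr_gt0.
have : 0 <= (1 - t) * (w - c) by rewrite mulr_ge0 ?subr_ge0// ltW.
lra.
Qed.

(** Two points of C that lie in neighboring orthants are joined by a segment of C
    that crosses the common wall of these orthants. Putting the coordinates of x
    one after the other, each orthant of the remaining coordinates keeps a point
    of C, until x itself is reached. *)
Lemma convex_corners C x : convex C ->
  (forall s : {ffun 'I_N -> bool}, exists2 p, C p &
    forall i, if s i then x ord0 i < p ord0 i else p ord0 i < x ord0 i) ->
  C x.
Proof.
move=> /convex_setP cC Cs.
suff H (j : nat) : (j <= N)%N -> forall s : {ffun 'I_N -> bool},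
    exists2 p, C p & forall i : 'I_N, if (i < j)%N then p ord0 i = x ord0 i
      else if s i then x ord0 i < p ord0 i else p ord0 i < x ord0 i.
  have [p Cp px] := H N (leqnn _) [ffun=> true].
  suff -> : x = p by [].
  by apply/rowP => i; have := px i; rewrite ltn_ord.
elim: j => [_ s|j IH jN s].
  by have [p Cp px] := Cs s; exists p => // i; exact: px.
pose jj := Ordinal jN.
have [p Cp px] := IH (ltnW jN) [ffun i => if i == jj then true else s i].
have [q Cq qx] := IH (ltnW jN) [ffun i => if i == jj then false else s i].
have := px jj; have := qx jj; rewrite /= ltnn !ffunE eqxx => qj pj.
pose t := (x ord0 jj - q ord0 jj) / (p ord0 jj - q ord0 jj).
have t01 : 0 <= t <= 1.
  rewrite divr_ge0/= ?ler_pdivrMr; lra.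
exists (t *: p + (1 - t) *: q); first exact: cC.
move=> i; rewrite ltnS leq_eqVlt !mxE.
have [->|ij] := eqVneq i jj.
  rewrite eqxx/=.
  have -> : t * p ord0 jj + (1 - t) * q ord0 jj =
    t * (p ord0 jj - q ord0 jj) + q ord0 jj by lra.
  by rewrite /t divfK ?subrK//; lra.
have -> : (i == j :> nat) = false by apply/negbTE: ij.
have := px i; have := qx i; rewrite !ffunE (negbTE ij)/=.
case: ifP => _ Hq Hp.
  by rewrite Hq Hp; lra.
case: ifP Hq Hp => _ Hq Hp; first exact: conv_gt.
have := @conv_gt t (- p ord0 i) (- q ord0 i) (- x ord0 i) t01.
rewrite !ltrN2 => /(_ Hp Hq); lra.
Qed.

(** The same points serve as corners for all points near x. *)
Lemma convex_corners_nbhs C x : convex C ->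
  (forall s : {ffun 'I_N -> bool}, exists2 p, C p &
    forall i, if s i then x ord0 i < p ord0 i else p ord0 i < x ord0 i) ->
  nbhs x C.
Proof.
move=> cC Cs.
have /choice[p Hp] : forall s : {ffun 'I_N -> bool}, exists p : E, C p /\
    forall i, if s i then x ord0 i < p ord0 i else p ord0 i < x ord0 i.
  by move=> s; have [p] := Cs s; exists p.
have : nbhs x [set y : E | forall (s : {ffun 'I_N -> bool}) (i : 'I_N),
    if s i then y ord0 i < p s ord0 i else p s ord0 i < y ord0 i].
  have nF := nbhs_filter x.
  apply: (@filter_forall _ _ (fun (s : {ffun 'I_N -> bool}) y => forall i : 'I_N,
    if s i then y ord0 i < p s ord0 i else p s ord0 i < y ord0 i) _ nF) => s.
  apply: (@filter_forall _ _ (fun (i : 'I_N) y =>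
    if s i then y ord0 i < p s ord0 i else p s ord0 i < y ord0 i) _ nF) => i.
  have := (Hp s).2 i; case: ifP => _ xp.
    exact: (@coord_continuous R 1 N ord0 i x _ (lt_nbhsl xp)).
  exact: (@coord_continuous R 1 N ord0 i x _ (lt_nbhsr xp)).
apply: filterS => y Hy; apply: convex_corners => // s.
by exists (p s); [exact: (Hp s).1|exact: Hy].
Qed.

(** A criterion to recognize interior points of C: having points of C in all the
    small balls near x, as each orthant contains such a ball. *)
Lemma ball_corners C x e : convex C -> 0 < e ->
  (forall v, ball x e v -> forall d, 0 < d -> ball v d `<=` ball x e ->
    exists2 p, C p & ball v d p) -> nbhs x C.
Proof.
move=> cC e0 HC; apply: convex_corners_nbhs => // s.
pose v : E := \row_i (x ord0 i + (if s i then e / 2 else - (e / 2))).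
have e20 : 0 < e / 2 by lra.
have xv : ball x e v.
  apply/rV_ballP => // i; rewrite !mxE ltr_norml.
  by case: ifP => _; lra.
have vx : ball v (e / 2) `<=` ball x e.
  move=> y /(rV_ballP _ _ e20) Hy; apply/rV_ballP => // i.
  have := Hy i; rewrite !mxE !ltr_norml.
  by case: ifP => _; lra.
have [p Cp /(rV_ballP _ _ e20) vp] := HC v xv _ e20 vx.
exists p => // i; have := vp i; rewrite !mxE ltr_norml.
by case: ifP => _; lra.
Qed.

Lemma convex_nbhs_closure C x : convex C -> nbhs x (closure C) -> nbhs x C.
Proof.
move=> cC /nbhs_ballP[e /= e0 eC]; apply: (ball_corners _ e0) => // v xv d d0 _.
have [p [Cp vp]] := eC v xv _ (nbhsx_ballx v d d0).
by exists p.
Qed.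

Lemma convex_closure C : convex C -> convex (closure C).
Proof.
move=> /convex_setP cC; apply/convex_setP => x y t clx cly t01.
move=> B /nbhs_ballP[e /= e0 eB].
have [x' [Cx' /(rV_ballP _ _ e0) xx']] := clx _ (nbhsx_ballx x e e0).
have [y' [Cy' /(rV_ballP _ _ e0) yy']] := cly _ (nbhsx_ballx y e e0).
exists (t *: x' + (1 - t) *: y'); split; first exact: cC.
apply: eB; apply/rV_ballP => // i; rewrite !mxE.
have := xx' i; have := yy' i; rewrite !ltr_norml => /andP[y1 y2] /andP[x1 x2].
have := @conv_gt t _ _ _ t01 x1 y1.
rewrite -ltrN2 opprD in x2; rewrite -ltrN2 opprD in y2.
by have := @conv_gt t _ _ _ t01 x2 y2; lra.
Qed.

(** The homothety of centre x and ratio r maps the ball of radius d into C if x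
    is in C; half of the radius is given up to approximate x by points of C. *)
Lemma convex_cone C x v d r : convex C -> closure C x ->
  ball (x + v) d `<=` C -> 0 < d -> 0 < r <= 1 ->
  ball (x + r *: v) (r * (d / 2)) `<=` C.
Proof.
move=> /convex_setP cC clx dC d0 /andP[r0 r1] z.
have rd0 : 0 < r * (d / 2) by rewrite mulr_gt0//; lra.
move=> /(rV_ballP _ _ rd0) Hz.
have [y [Cy /(rV_ballP _ _ rd0) xy]] := clx _ (nbhsx_ballx x _ rd0).
pose w := r^-1 *: (z - (1 - r) *: y).
have -> : z = r *: w + (1 - r) *: y.
  by rewrite /w scalerA divff ?gt_eqF// scale1r subrK.
apply: cC => //; last by rewrite r1 ltW.
apply: dC; apply/rV_ballP => // i.
have rw : r * w ord0 i = z ord0 i - (1 - r) * y ord0 i.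
  by rewrite !mxE mulrA divff ?gt_eqF// mul1r.
suff : forall u u' : R, `|r * (u - u')| < r * d -> `|u - u'| < d.
  apply; rewrite mulrBr rw !mxE; move: (Hz i) (xy i).
  by rewrite !mxE !ltr_norml; nra.
by move=> u u'; rewrite normrM gtr0_norm// ltr_pM2l.
Qed.

(** Let r tend to 0 in [convex_cone], with v = c - x. *)
Lemma convex_closure_interior C c d : convex C -> 0 < d -> ball c d `<=` C ->
  closure C `<=` closure C°.
Proof.
move=> cC d0 dC x clx B xB.
have : x + r *: (c - x) @[r --> (0 : R)^'+] --> x + 0 *: (c - x).
  apply: cvgD; first exact: cvg_cst.
  by apply: cvgZr_tmp; apply: cvg_at_right_filter; exact: cvg_id.
rewrite scale0r addr0 => /(_ _ xB) Bx.
near (0 : R)^'+ => r.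
have rd0 : 0 < r * (d / 2) by rewrite mulr_gt0//; lra.
exists (x + r *: (c - x)); split; last by near: r.
apply/nbhs_ballP; exists (r * (d / 2)) => //.
apply: convex_cone => //; first by rewrite addrC subrK.
by apply/andP; split; near: r; [exact: nbhs_right_gt|exact: nbhs_right_le].
Unshelve. all: by end_near. Qed.

End convex.

(** * Convex sets without interior are null *)

Section convex_null.
Context {R : realType} {N : nat}.
Local Notation E := 'rV[R]_N.
Local Notation mu := (@lebesgue_measure_rV R N).
Local Notation convex := (@convex_set R E).
Implicit Types (x y v : E) (A C D : set E) (e d r t : R).

(** Infinitely many disjoint translates of a set of positive measure do not fit
    into a bounded region; so the translates of D by v / (j + 1) cannot be
    pairwise disjoint, and D contains two points that differ by a multiple of
    v. *)
Lemma overlapping_translates D (v : E) M : 0 < M ->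
  measurable (D : set (lebesgue_rV R N)) -> D `<=` ball 0 M ->
  mu D != 0%E -> exists x t, [/\ 0 < t, D x & D (x + t *: v)].
Proof.
move=> M0 mD DM D0; apply/not_existsP => /= noD.
pose u (j : nat) : R := j.+1%:R^-1.
pose F (j : nat) : set (lebesgue_rV R N) := [set x + u j *: v | x in D].
have mF j : measurable (F j) by exact: measurable_translate.
have tF : trivIset setT F.
  suff H i j : u i < u j -> F i `&` F j = set0.
    apply/trivIsetP => i j _ _ ij.
    have [uij|uij|/invr_inj/eqP] := ltgtP (u i) (u j); first exact: H.
      by rewrite setIC; exact: H.
    by rewrite eqr_nat eqSS (negbTE ij).
  move=> uij; apply/seteqP; split => // _ [[x Dx <-] [y Dy yx]].
  apply: (noD y); exists (u j - u i); split => //; first by rewrite subr_gt0.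
  by rewrite scalerBl addrA yx addrK.
pose L := 1 + M + \sum_i `|v ord0 i|.
have L0 : 0 < L by rewrite ltr_pwDl// ?addr_gt0// sumr_ge0.
have FL : \bigcup_j F j `<=` ball 0 L.
  move=> _ [j _ [x Dx <-]]; apply/rV_ballP => // i.
  have /(rV_ballP _ _ M0)/(_ i) := DM _ Dx; rewrite !mxE !sub0r !normrN => xM.
  rewrite (le_lt_trans (ler_normD _ _))// /L.
  have : `|u j * v ord0 i| <= `|v ord0 i|.
    by rewrite normrM ler_piMl// ger0_norm ?invr_ge0// invf_le1 ?ler1n// ltr0n.
  have : `|v ord0 i| <= \sum_k `|v ord0 k|.
    by rewrite (bigD1 i)//= lerDl sumr_ge0.
  lra.
have : (mu (\bigcup_j F j) <= mu (ball 0%R L))%E by exact: le_lebesgue_outer.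
rewrite measure_bigcup//.
rewrite (eq_eseriesr (g := fun=> mu D)); last first.
  by move=> j _; exact: lebesgue_translate.
have Dfin : mu D \is a fin_num.
  rewrite ge0_fin_numE ?lebesgue_outer_ge0//.
  by rewrite (le_lt_trans (le_lebesgue_outer DM))// [ltLHS]lebesgue_ball ?ltry.
rewrite lebesgue_ball// -(fineK Dfin) => muDL.
have c0 : 0 < fine (mu D).
  by rewrite fine_gt0// lt_neqAle eq_sym D0 lebesgue_outer_ge0
    -ge0_fin_numE// lebesgue_outer_ge0.
pose K := (2 * L) ^+ N; pose n := Num.bound (K / fine (mu D)).
have ncD : ((fine (mu D) *+ n)%:E <=
    \sum_(i <oo | i \in [set: nat]) (fine (mu D))%:E)%E.
  apply: le_trans (nneseries_lim_ge n _); last by move=> *; rewrite lee_fin ltW.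
  by under eq_bigl do rewrite in_setT; rewrite sumEFin sumr_const_nat subn0.
have := le_trans ncD muDL.
rewrite lee_fin leNgt -[_ *+ n]mulr_natl -ltr_pdivrMr// archi_boundP//.
by rewrite divr_ge0 ?ltW// exprn_gt0// mulr_gt0.
Qed.

(** The average of N segments in the N coordinate directions is a box. It is built
    one direction at a time, by midpoints of a box of dimension j with a
    segment in a new direction. *)
Lemma segments_ball C : convex C -> C !=set0 ->
  (forall i : 'I_N, exists x t, [/\ 0 < t, C x & C (x + t *: delta_mx 0 i)]) ->
  exists x d, 0 < d /\ ball x d `<=` C.
Proof.
move=> /convex_setP cC [c Cc] Cseg.
suff H (j : nat) : (j <= N)%N -> exists (q : E) d, 0 < d /\ forall y : E,
    (forall i : 'I_N, if (i < j)%N then `|q ord0 i - y ord0 i| < d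
                      else y ord0 i == q ord0 i) -> C y.
  have [q [d [d0 qC]]] := H N (leqnn _); exists q, d; split => // y.
  by move=> /(rV_ballP _ _ d0) qy; apply: qC => i; rewrite ltn_ord.
elim: j => [_|j IH jN].
  exists c, 1; split => // y yc; suff -> : y = c by [].
  by apply/rowP => i; exact/eqP/yc.
have [q [d [d0 qC]]] := IH (ltnW jN).
pose jj := Ordinal jN.
have [p [t [t0 Cp Cpt]]] := Cseg jj.
pose q' : E := 2^-1 *: (q + p + (t / 2) *: delta_mx 0 jj).
have q'E i : q' ord0 i = 2^-1 * (q ord0 i + p ord0 i + t / 2 * (i == jj)%:R).
  by rewrite !mxE eqxx.
pose d' := Num.min (d / 2) (t / 4).
have [d'd d't] : d' <= d / 2 /\ d' <= t / 4.
  by rewrite /d' !ge_min !lexx orbT.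
exists q', d'; split; first by rewrite lt_min; apply/andP; lra.
move=> y Hy.
(* [w] is the point of the segment for which [2 y - w], the reflection of [w] in
   [y], belongs to the previous box *)
pose s := 2^-1 + 2 / t * (y ord0 jj - q' ord0 jj).
have ts : t * s = t / 2 + 2 * (y ord0 jj - q' ord0 jj).
  by rewrite /s; field; rewrite gt_eqF.
pose w := p + (t * s) *: delta_mx 0 jj.
have Cw : C w.
  have -> : w = s *: (p + t *: delta_mx 0 jj) + (1 - s) *: p.
    by apply/rowP => i; rewrite !mxE; ring.
  apply: cC => //.
  have := Hy jj; rewrite /= ltnSn ltr_norml => Hyj.
  apply/andP; split; first by rewrite ltW// -(pmulr_rgt0 _ t0) ts; lra.
  by rewrite -(ler_pM2l t0) ts; lra.
have -> : y = 2^-1 *: (2 *: y - w : E) + (1 - 2^-1) *: w.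
  by apply/rowP => i; rewrite !mxE; lra.
apply: cC => //; last by lra.
apply: qC => i; have := Hy i.
rewrite q'E !mxE ltnS leq_eqVlt eqxx/= ts.
have [->|ij] := eqVneq i jj.
  rewrite eqxx ltnn/= => _; apply/eqP; rewrite q'E eqxx !mulr1n; lra.
have -> : (i == j :> nat) = false by apply/negbTE: ij.
rewrite orFb.
case: ifP => _; first by rewrite !mulr0n !ltr_norml; lra.
by rewrite !mulr0n => /eqP ->; apply/eqP; lra.
Qed.

(** By [overlapping_translates], a bounded piece of the closure has a segment in
    every coordinate direction, so that the closure has interior points by
    [segments_ball]; these are interior to C. *)
Lemma convex_nonnull_ball C : convex C -> mu (closure C) != 0%E ->
  exists x d, 0 < d /\ ball x d `<=` C.
Proof.
move=> cC muC.
have [n muD] : exists n : nat, mu (closure C `&` ball 0%R n.+1%:R) != 0%E.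
  apply: contrapT => /forallNP H; move/negP: muC; apply; apply/eqP.
  apply/le_anti/andP; split; last exact: lebesgue_outer_ge0.
  have sub : closure C `<=` \bigcup_n (closure C `&` ball 0%R n.+1%:R).
    move=> x Cx; pose M := \sum_i `|x ord0 i|.
    exists (Num.bound M) => //; split => //; apply/rV_ballP => // i.
    rewrite mxE sub0r normrN.
    apply: (@le_lt_trans _ _ M); first by rewrite /M (bigD1 i)//= lerDl sumr_ge0.
    apply: (lt_trans (archi_boundP _)); first exact: sumr_ge0.
    by rewrite ltr_nat.
  apply: le_trans (le_lebesgue_outer sub) _.
  apply: le_trans (lebesgue_outer_sigma_subadditive _) _.
  by rewrite eseries0// => k _ _; apply/eqP/negPn/negP/H.
set D := closure C `&` _ in muD.
have mD : measurable (D : set (lebesgue_rV R N)).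
  apply: measurableI; first exact/measurable_closed_rV/closed_closure.
  exact: measurable_ball_rV.
have CD : closure C !=set0.
  apply/set0P; apply: contraNneq muC => ->.
  by rewrite /lebesgue_measure_rV lebesgue_outer0.
have [x [d [d0 xd]]] : exists x d, 0 < d /\ ball x d `<=` closure C.
  apply: segments_ball CD _; first exact: convex_closure.
  move=> i; have [x [t [t0 [Dx _] [Dxt _]]]] :=
    overlapping_translates (delta_mx 0 i) (ltr0Sn R n) mD (@subIsetr _ _ _) muD.
  by exists x, t.
have /nbhs_ballP[e /= e0 eC] : nbhs x C.
  by apply: convex_nbhs_closure => //; apply/nbhs_ballP; exists d.
by exists x, e.
Qed.

End convex_null.

(** * Sets of density one *)

Section density.
Context {R : realType} {N : nat}.
Local Notation E := 'rV[R]_N.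
Local Notation mu := (@lebesgue_measure_rV R N).
Local Notation convex := (@convex_set R E).
Implicit Types (x y v : E) (A C D U Z : set E) (e d r t : R).

Lemma euclidean_ball_sub x r : 0 < r -> euclidean_ball x r `<=` ball x r.
Proof.
move=> r0 y xy; apply/rV_ballP => // i; apply: le_lt_trans xy.
rewrite distrC -sqrtr_sqr; apply: ler_wsqrtr.
by rewrite (bigD1 i)//= lerDl sumr_ge0// => j _; exact: sqr_ge0.
Qed.

(** Any constant larger than the square root of N would do in place of N + 1. *)
Lemma sub_euclidean_ball x r : 0 < r ->
  ball x (r / N.+1%:R) `<=` euclidean_ball x r.
Proof.
move=> r0 y; have rN0 : 0 < r / N.+1%:R by rewrite divr_gt0.
move=> /(rV_ballP _ _ rN0) xy; rewrite /euclidean_ball/= -[ltRHS](gtr0_norm r0).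
rewrite -[ltRHS]sqrtr_sqr ltr_sqrt ?exprn_gt0//.
apply: (@le_lt_trans _ _ (\sum_(i < N) (r / N.+1%:R) ^+ 2)).
  apply: ler_sum => i _; rewrite -real_normK ?num_real//.
  by rewrite lerXn2r ?nnegrE// ?ltW// distrC.
rewrite sumr_const card_ord expr_div_n -mulrnAr -mulr_natl.
rewrite gtr_pMr ?exprn_gt0// ltr_pdivrMr ?exprn_gt0// mul1r -natrX ltr_nat.
by rewrite (leq_trans (ltnSn N))// -{1}[N.+1]expn1 leq_pexp2l.
Qed.

Lemma euclidean_ball_measure x r : 0 < r ->
  exists b : R, [/\ mu (euclidean_ball x r) = b%:E, 0 < b & b <= (2 * r) ^+ N].
Proof.
move=> r0; have muge0 : (0 <= mu (euclidean_ball x r))%E.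
  exact: lebesgue_outer_ge0.
have le : (mu (euclidean_ball x r) <= ((2 * r) ^+ N)%:E)%E.
  rewrite -(lebesgue_ball x)//; apply: le_lebesgue_outer.
  exact: euclidean_ball_sub.
have fin : mu (euclidean_ball x r) \is a fin_num.
  by rewrite ge0_fin_numE// (le_lt_trans le)// ltry.
exists (fine (mu (euclidean_ball x r))); rewrite fineK//; split => //.
  rewrite fine_gt0// -ge0_fin_numE// fin andbT.
  apply: lt_le_trans (lebesgue_ball_gt0 x (_ : 0 < r / N.+1%:R)) _.
    by rewrite divr_gt0.
  by apply: le_lebesgue_outer; exact: sub_euclidean_ball.
by rewrite -lee_fin fineK.
Qed.

Lemma at_right0P (P : set R) : (\forall r \near (0 : R)^'+, P r) ->
  exists2 e, 0 < e & forall r, 0 < r < e -> P r.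
Proof.
move=> /nbhs_ballP[e /= e0 eP]; exists e => // r /andP[r0 re].
by apply: eP => //; rewrite /ball/= sub0r normrN gtr0_norm.
Qed.

(** The balls B(x + r v, r d) fill the fixed proportion c = (d / M)^N of cubes that
    contain the euclidean balls B(x, M r), where M is chosen such that the latter
    contain the former. If they all missed U, then the density of U at x would
    be at most 1 - c. *)
Lemma density_one_meets U x v d : density_one U x -> 0 < d ->
  exists r y, [/\ 0 < r <= 1, U y & ball (x + r *: v) (r * d) y].
Proof.
move=> Ux d0.
pose M := N.+1%:R * (\sum_i `|v ord0 i| + d).
have S0 : 0 <= \sum_i `|v ord0 i| by exact: sumr_ge0.
have M0 : 0 < M by rewrite mulr_gt0// ltr_wpDl.
pose c := (d / M) ^+ N.
have c0 : 0 < c by rewrite exprn_gt0// divr_gt0.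
have [e e0 He] : exists2 e, 0 < e & forall r, 0 < r < e ->
    ((1 - c)%:E < mu (U `&` euclidean_ball x r) *
                  (mu (euclidean_ball x r))^-1)%E.
  have c1 : ((1 - c)%:E < 1)%E by rewrite lte_fin; lra.
  by apply: at_right0P; exact: (Ux _ (open_ereal_gt' c1)).
pose r := Num.min 1 (e / M / 2).
have r0 : 0 < r by rewrite lt_min ltr01/= !divr_gt0.
have Mr0 : 0 < M * r by rewrite mulr_gt0.
have Mre : M * r < e.
  have : r <= e / M / 2 by rewrite ge_min lexx orbT.
  rewrite -(ler_pM2l M0) => /le_lt_trans; apply.
  have -> : M * (e / M / 2) = e / 2 by field; rewrite gt_eqF.
  lra.
have rd0 : 0 < r * d by rewrite mulr_gt0.
apply: contrapT => noU.
have UP y : U y -> ~ ball (x + r *: v) (r * d) y.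
  move=> Uy By; apply: noU; exists r, y; split => //.
  by rewrite r0 ge_min lexx.
pose P := ball (x + r *: v) (r * d).
pose B := euclidean_ball x (M * r).
have PB : P `<=` B.
  move=> y /(rV_ballP _ _ rd0) Hy; apply: sub_euclidean_ball => //.
  have -> : M * r / N.+1%:R = r * (\sum_i `|v ord0 i| + d).
    by rewrite /M; field; rewrite nat1r pnatr_eq0.
  apply/rV_ballP => [|i]; first by rewrite mulr_gt0// ltr_wpDl.
  have := Hy i; rewrite !mxE => Hi.
  have -> : x ord0 i - y ord0 i =
    (x ord0 i + r * v ord0 i - y ord0 i) - r * v ord0 i by ring.
  rewrite (le_lt_trans (ler_normB _ _))// normrM (gtr0_norm r0) mulrDr addrC.
  rewrite ler_ltD// ler_pM2l// (bigD1 i)//= lerDl.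
  exact: sumr_ge0.
have [b [Bb b0 bM]] := euclidean_ball_measure x Mr0.
have mP : measurable (P : set (lebesgue_rV R N)) by exact: measurable_ball_rV.
have muP : mu P = (c * (2 * (M * r)) ^+ N)%:E.
  rewrite lebesgue_ball//; congr (_%:E); rewrite -exprMn; congr (_ ^+ _).
  by field; rewrite gt_eqF.
have UBP : (mu (U `&` B) + mu P <= mu B)%E.
  rewrite [leRHS](mP B) addeC; apply: leeD; apply: le_lebesgue_outer.
    by move=> y Py; split => //; exact: PB.
  by move=> y [Uy By]; split => //; exact: UP.
have UBge0 : (0 <= mu (U `&` B))%E by exact: lebesgue_outer_ge0.
have UBle : (mu (U `&` B) <= (b - c * b)%:E)%E.
  move: UBP; rewrite -/B in Bb; rewrite Bb muP -leeBrDr// => /le_trans; apply.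
  by rewrite -EFinB lee_fin lerB// ler_pM2l.
have := He _ (andb_true_intro (conj Mr0 Mre)).
rewrite -/B Bb inver gt_eqF// ltNge => /negP; apply.
have bV0 : (0 <= b^-1%:E)%E by rewrite lee_fin invr_ge0 ltW.
apply: le_trans (lee_wpmul2r bV0 UBle) _.
by rewrite -EFinM lee_fin mulrBl mulfK ?gt_eqF// mulfV ?gt_eqF.
Qed.

(** For small r, the set U meets each of the cubes with centre x + r v and radius
    r / 2, where v runs over the vectors of signs; these cubes lie in the
    different orthants with vertex x. *)
Lemma density_one_interior C U x : convex C -> density_one U x -> U `<=` C ->
  nbhs x C.
Proof.
move=> cC Ux UC; apply: convex_corners_nbhs => // s.
have h0 : 0 < 2^-1 :> R by lra.
have [r [p [/andP[r0 _] Up]]] :=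
  density_one_meets (\row_i (if s i then 1 else -1)) Ux h0.
have rh0 : 0 < r / 2 by rewrite mulr_gt0.
move=> /(rV_ballP _ _ rh0) Hp; exists p; first exact: UC.
by move=> i; have := Hp i; rewrite !mxE ltr_norml; case: ifP => _; lra.
Qed.

(** The small homothetic balls of [convex_cone] have the shape of the balls in
    [density_one_meets]. *)
Lemma density_one_closure C U x : convex C -> C° !=set0 -> closure C x ->
  density_one U x -> U `&` C !=set0.
Proof.
move=> cC [c /nbhs_ballP[d /= d0 dC]] clx Ux.
have d20 : 0 < d / 2 by lra.
have [r [p [r01 Up Hp]]] := density_one_meets (c - x) Ux d20.
exists p; split => //; apply: (convex_cone cC clx _ d0 r01 Hp).
by rewrite addrC subrK.
Qed.

Lemma density_open_ball x d Z : 0 < d -> mu Z = 0%E ->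
  density_open (ball x d `\` Z).
Proof.
move=> d0 Z0; have mZ := measurable_null Z0.
split; first by apply: measurableD => //; exact: measurable_ball_rV.
move=> y [xy nZy]; apply: cvg_near_cst.
have /nbhs_ballP[e /= e0 eB] : nbhs y (ball x d).
  by apply: open_nbhs_nbhs; split => //; exact: ball_open.
near=> r.
have r0 : 0 < r by [].
have [b [Bb b0 _]] := euclidean_ball_measure y r0.
suff -> : mu ((ball x d `\` Z) `&` euclidean_ball y r) = b%:E.
  by rewrite Bb inver gt_eqF// -EFinM mulfV// gt_eqF.
rewrite -Bb; apply/le_anti/andP; split; first by apply: le_lebesgue_outer.
have sub : euclidean_ball y r `<=`
    ((ball x d `\` Z) `&` euclidean_ball y r) `|` Z.
  move=> z yz; have [Zz|nZz] := pselect (Z z); [by right|left].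
  split => //; split => //; apply: eB; apply: (@le_ball _ _ _ r).
    by near: r; exact: nbhs_right_le.
  exact: euclidean_ball_sub.
apply: le_trans (le_lebesgue_outer sub) _.
apply: le_trans (outer_measureU2 (@lebesgue_outer R N) _ _) _ => /=.
by rewrite [X in (_ + X)%E]Z0 adde0.
Unshelve. all: by end_near. Qed.

(** Near an interior point of C every ball has positive measure, so it is not
    contained in C `\` D. *)
Lemma ae_eq_convex_nbhs C D Z x : convex D -> mu Z = 0%E -> C `\` D `<=` Z ->
  nbhs x C -> nbhs x D.
Proof.
move=> cD Z0 CDZ /nbhs_ballP[e /= e0 eC].
apply: (ball_corners cD e0) => v _ d d0 de; apply: contrapT => noD.
have : (mu (ball v d) <= mu Z)%E.
  apply: le_lebesgue_outer => y vy; apply: CDZ; split; first exact/eC/de.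
  by move=> Dy; apply: noD; exists y.
by rewrite Z0 leNgt lebesgue_ball_gt0.
Qed.

End density.

(** * Quasiconvex functions *)

Section quasiconvex.
Context {R : realType} {N : nat}.
Local Notation E := 'rV[R]_N.
Local Notation mu := (@lebesgue_measure_rV R N).
Implicit Types (f g : E -> R) (x y : E) (A Z : set E) (a b l : R).

Lemma ae_null (P : E -> Prop) : (\forall x \ae mu, P x) <->
  mu (~` [set x | P x]) = 0%E.
Proof.
split => [[A [mA A0 PA]]|P0].
  apply/le_anti; rewrite lebesgue_outer_ge0 andbT -A0.
  exact: le_lebesgue_outer.
exists (~` [set x | P x] : set (lebesgue_rV R N)); split => //.
exact: measurable_null.
Qed.

Lemma le_ess_inf_null f (m : \bar R) : (m <= ess_inf mu (EFin \o f))%E <->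
  mu [set y | ((f y)%:E < m)%E] = 0%E.
Proof.
have -> : [set y | ((f y)%:E < m)%E] = ~` [set y | (m <= (f y)%:E)%E].
  by apply/seteqP; split => y /=; rewrite ltNge => /negP.
by rewrite -ae_null; split => /ess_infP.
Qed.

Lemma convex_esublevel f (m : \bar R) : quasiconvex f ->
  @convex_set R E [set y | ((f y)%:E < m)%E].
Proof.
move=> qf; case: m => [a| |].
- exact: qf.
- by apply/convex_setP => x y t _ _ _ /=; rewrite ltry.
- by apply/convex_setP => x y t /=; rewrite ltNge leNye.
Qed.

Lemma continuous_sandwich f x l :
  (forall a, l < a -> nbhs x [set y | f y < a]) ->
  (forall b, b < l -> nbhs x [set y | b <= f y]) ->
  f x = l /\ {for x, continuous f}.
Proof.
move=> usc lsc.
have fxl : f x = l.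
  apply/le_anti/andP; split.
    apply/ler_addgt0Pr => e e0.
    by apply/ltW/(nbhs_singleton (usc (l + e) _)); rewrite ltrDl.
  apply/ler_addgt0Pr => e e0; rewrite -lerBlDr.
  by apply: (nbhs_singleton (lsc (l - e) _)); rewrite ltrBlDr ltrDl.
split => // V /nbhs_ballP[e /= e0 eV]; rewrite fxl in eV.
have le : l < l + e by rewrite ltrDl.
have el : l - e / 2 < l by lra.
have := @filterI _ _ (nbhs_filter x) _ _ (usc _ le) (lsc _ el).
apply: (@filterS _ _ (nbhs_filter x)).
by move=> y [/= ? ?]; apply: eV; rewrite /ball/= ltr_norml; lra.
Qed.

(** Removing a null set from a ball leaves a density open set. *)
Lemma approx_continuous_off_null f x Z : mu Z = 0%E -> ~ Z x ->
  (forall e, 0 < e -> \forall y \near x, ~ Z y -> `|f x - f y| < e) ->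
  approx_continuous_at x f.
Proof.
move=> Z0 Zx fx V /nbhs_ballP[e /= e0 eV].
have /nbhs_ballP[d /= d0 dZ] := fx _ e0.
exists (ball x d `\` Z); split.
- exact: density_open_ball.
- by split => //; exact: ballxx.
- by move=> y [xy nZy]; apply: eV; exact: dZ.
Qed.

Lemma continuous_approx f x : {for x, continuous f} -> approx_continuous_at x f.
Proof.
move=> fx; apply: (@approx_continuous_off_null f x set0) => //.
move=> e e0; have /(@cvgrPdist_lt _ _ _ _ (nbhs_filter x))/(_ e e0) := fx.
by apply: (@filterS _ _ (nbhs_filter x)) => y.
Qed.

Lemma approx_continuous_nbhs f x (V : set R) : approx_continuous_at x f ->
  nbhs (f x) V -> exists2 U, density_one U x & U `<=` f @^-1` V.
Proof.
by move=> /[apply] -[U [[_ Uone] Ux UV]]; exists U => //; exact: Uone.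
Qed.

Lemma approx_continuous_lt g x a : quasiconvex g ->
  approx_continuous_at x g -> g x < a -> nbhs x [set y | g y < a].
Proof.
move=> qg gx ga; have [U U1 Ug] := approx_continuous_nbhs gx (lt_nbhsl ga).
exact: (density_one_interior (@qg a) U1 Ug).
Qed.

(** Otherwise x would be interior to some null set {g < a}. *)
Lemma ess_inf_le_approx_continuous g x : quasiconvex g ->
  approx_continuous_at x g -> (ess_inf mu (EFin \o g) <= (g x)%:E)%E.
Proof.
move=> qg gx; rewrite leNgt; apply/negP => gm.
have [a ga am] : exists2 a, g x < a & (a%:E <= ess_inf mu (EFin \o g))%E.
  move: gm; case: (ess_inf _ _) => [a| |]//.
  - by rewrite lte_fin; exists a.
  - by move=> _; exists (g x + 1); rewrite ?ltrDl ?leey.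
have /nbhs_ballP[e /= e0 eg] := approx_continuous_lt qg gx ga.
have := le_lebesgue_outer eg; rewrite leNgt.
have /le_ess_inf_null ga0 := am.
by rewrite [ltLHS]ga0 lebesgue_ball_gt0.
Qed.

Lemma ae_eq_sublevel_nbhs f g a x : quasiconvex f ->
  (\forall x \ae mu, f x = g x) ->
  nbhs x [set y | g y < a] -> nbhs x [set y | f y < a].
Proof.
move=> qf /ae_null fg0; apply: (ae_eq_convex_nbhs (@qf a) fg0).
by move=> y [/= ga fa] fgy; apply: fa; rewrite /= fgy.
Qed.

Section ae_equal.
Context (f g : E -> R) (qf : quasiconvex f) (qg : quasiconvex g)
  (fg : \forall x \ae mu, f x = g x).
Let m := ess_inf mu (EFin \o f).

Lemma ess_inf_ae_eq : ess_inf mu (EFin \o g) = m.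
Proof.
have /ae_null fg0 := fg.
apply: eq_ess_inf; apply/ae_null/le_anti.
rewrite lebesgue_outer_ge0 andbT -fg0.
by apply: le_lebesgue_outer => x /= nfg fgx; apply: nfg; rewrite fgx.
Qed.

Let interior_fg a x : nbhs x [set y | g y < a] -> nbhs x [set y | f y < a].
Proof. exact: ae_eq_sublevel_nbhs. Qed.

Let interior_gf a x : nbhs x [set y | f y < a] -> nbhs x [set y | g y < a].
Proof.
apply: ae_eq_sublevel_nbhs => //; have /ae_null fg0 := fg.
apply/ae_null/le_anti; rewrite lebesgue_outer_ge0 andbT -fg0.
by apply: le_lebesgue_outer => y /= ngf fgy; apply: ngf; rewrite fgy.
Qed.

(** The set {f < b} is not null, so it has interior points; hence it has the same
    closure as {g < b}, which does not contain x because {g > b} contains a set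
    of density one at x. *)
Let approx_ge b x : approx_continuous_at x g -> (m < b%:E)%E -> b < g x ->
  nbhs x [set y | b <= f y].
Proof.
move=> gx mb bg.
have [c [d [d0 cd]]] : exists x d, 0 < d /\ ball x d `<=` [set y | f y < b].
  apply: convex_nonnull_ball; first exact: qf.
  apply/eqP => cl0; move: mb; rewrite ltNge => /negP; apply.
  apply/le_ess_inf_null/le_anti; rewrite lebesgue_outer_ge0 andbT -cl0.
  by apply: le_lebesgue_outer; exact: subset_closure.
have [U U1 Ug] := approx_continuous_nbhs gx (lt_nbhsr bg).
have ngx : ~ closure [set y | g y < b] x.
  have intg : [set y | g y < b]° !=set0.
    by exists c; apply: interior_gf; apply/nbhs_ballP; exists d.
  move=> clx.
  have [y [/Ug/= bgy gyb]] := density_one_closure (@qg b) intg clx U1.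
  by have := lt_trans bgy gyb; rewrite ltxx.
have nfx : ~ closure [set y | f y < b] x.
  move=> /(convex_closure_interior (@qf b) d0 cd) clx; apply: ngx.
  by move: clx; apply: closureS => y /interior_gf/nbhs_singleton.
have : nbhs x (~` closure [set y | f y < b]).
  by apply: open_nbhs_nbhs; split => //; exact/closed_openC/closed_closure.
apply: filterS => y ny; rewrite /= leNgt; apply/negP => fb.
by apply: ny; exact: subset_closure.
Qed.

(** Only the values b close to g x matter, and these exceed m. *)
Lemma continuous_of_lt x : approx_continuous_at x g -> (m < (g x)%:E)%E ->
  {for x, continuous f}.
Proof.
move=> gx mg; apply: (proj2 (continuous_sandwich (l := g x) _ _)).
  by move=> a ga; apply/interior_fg/(approx_continuous_lt qg).
move=> b bg.
have [b' [bb' mb' b'g]] : exists b', [/\ b <= b', (m < b'%:E)%E & b' < g x].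
  case: m mg => [r| |]//.
    rewrite lte_fin => rg; exists ((Num.max b r + g x) / 2).
    have bmax : b <= Num.max b r by rewrite le_max lexx.
    have rmax : r <= Num.max b r by rewrite le_max lexx orbT.
    have maxg : Num.max b r < g x by rewrite gt_max bg rg.
    by split; rewrite ?lte_fin; lra.
  by move=> _; exists b; split => //; rewrite ltNyr.
by apply: filterS (approx_ge gx mb' b'g) => y /=; exact: le_trans.
Qed.

(** Outside of the null set {f < m} the lower estimate f >= g x is automatic. *)
Lemma approx_continuous_of_eq x : approx_continuous_at x g ->
  (g x)%:E = m -> (m <= (f x)%:E)%E -> approx_continuous_at x f.
Proof.
move=> gx gm mf.
have fgx : f x = g x.
  apply/le_anti/andP; split; last by rewrite -lee_fin gm.
  apply/ler_addgt0Pr => e e0; have ge : g x < g x + e by rewrite ltrDl.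
  exact/ltW/(nbhs_singleton (interior_fg (approx_continuous_lt qg gx ge))).
apply: (@approx_continuous_off_null _ _ [set y | ((f y)%:E < m)%E]).
- exact/le_ess_inf_null.
- by rewrite /= ltNge mf.
move=> e e0.
have ge : g x < g x + e by rewrite ltrDl.
have := interior_fg (approx_continuous_lt qg gx ge).
apply: filterS => y /= fe /negP; rewrite -leNgt -gm lee_fin fgx ltr_norml; lra.
Qed.

Lemma continuous_of_eq x : approx_continuous_at x g -> (g x)%:E = m ->
  ~ (\bigcup_(a in [set a | (a%:E < m)%E]) closure [set y | f y < a]) x ->
  {for x, continuous f}.
Proof.
move=> gx gm ncl; apply: (proj2 (continuous_sandwich (l := g x) _ _)).
  by move=> a ga; apply/interior_fg/(approx_continuous_lt qg).
move=> b bg.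
have : nbhs x (~` closure [set y | f y < b]).
  apply: open_nbhs_nbhs; split; first exact/closed_openC/closed_closure.
  by move=> clx; apply: ncl; exists b => //=; rewrite -gm lte_fin.
apply: filterS => y ny; rewrite /= leNgt; apply/negP => fb.
by apply: ny; exact: subset_closure.
Qed.

End ae_equal.
End quasiconvex.

Theorem theorem6 (R : realType) (N : nat) (f g : 'rV[R]_N -> R)
    (qf : quasiconvex f) (qg : quasiconvex g)
    (fg : \forall x \ae (@lebesgue_measure_rV R N), f x = g x) :
  let mu := @lebesgue_measure_rV R N in
  let m : \bar R := ess_inf mu (EFin \o f) in
  let F (a : \bar R) : set 'rV[R]_N := [set y | ((f y)%:E < a)%E] in
  let clF : set 'rV[R]_N :=
    \bigcup_(a in [set a : R | (a%:E < m)%E]) closure (F a%:E) in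
  ess_inf mu (EFin \o g) = m /\
  (* (i) *)
  [/\ forall x, approx_continuous_at x g -> (m <= (g x)%:E)%E,
      forall x, approx_continuous_at x g ->
        (~ approx_continuous_at x f <->
           [/\ (-oo < m)%E, (g x)%:E = m & F m x])
    & mu (F m) = 0%E] /\
  (* (ii) *)
  [/\ forall x, {for x, continuous g} -> (m <= (g x)%:E)%E,
      forall x, {for x, continuous g} ->
        (~ {for x, continuous f} <->
           [/\ (-oo < m)%E, (g x)%:E = m & clF x]),
      clF `<=` closure (F m)
    & mu (closure (F m)) = 0%E].
Proof.
move=> mu m F clF.
have mg : ess_inf mu (EFin \o g) = m by exact: ess_inf_ae_eq.
have m_le_g x : approx_continuous_at x g -> (m <= (g x)%:E)%E.
  by rewrite -mg; exact: ess_inf_le_approx_continuous.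
have m_le_f x : approx_continuous_at x f -> (m <= (f x)%:E)%E.
  exact: ess_inf_le_approx_continuous.
have Fm0 : mu (F m) = 0%E by exact/le_ess_inf_null.
split=> //; split; split => //.
- move=> x gx; split => [nfx|[_ _ fm] /m_le_f]; last by rewrite leNgt fm.
  have gm : (g x)%:E = m.
    apply/le_anti; rewrite m_le_g// andbT leNgt; apply/negP => mgx.
    exact/nfx/continuous_approx/(continuous_of_lt qf qg fg).
  split => //; first by rewrite -gm ltNyr.
  rewrite /F/= ltNge; apply/negP => mf; apply: nfx.
  exact: (approx_continuous_of_eq qf qg fg gx).
- by move=> x /continuous_approx/m_le_g.
- move=> x gx; have agx := continuous_approx gx.
  split => [nfx|[_ _ [a am clx]] fx].
    have gm : (g x)%:E = m.
      apply/le_anti; rewrite m_le_g// andbT leNgt; apply/negP => mgx.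
      exact/nfx/(continuous_of_lt qf qg fg).
    split => //; first by rewrite -gm ltNyr.
    apply: contrapT => nclx; apply: nfx.
    exact: (continuous_of_eq qf qg fg agx).
  (* values of [f] below [a] occur arbitrarily near [x], so continuity of [f] would
     give [f x <= a < m] *)
  have := m_le_f _ (continuous_approx fx).
  rewrite leNgt => /negP; apply; apply: le_lt_trans am; rewrite lee_fin leNgt.
  apply/negP => afx; have [y [/= fya afy]] := clx _ (fx _ (lt_nbhsr afx)).
  by move: fya; rewrite /F/= lte_fin ltNge (ltW afy).
- move=> x [a am]; apply: closureS => y /= fya.
  exact: lt_trans fya am.
- apply/eqP/negPn/negP => clF0.
  have [x [d [d0 dF]]] := convex_nonnull_ball (convex_esublevel qf) clF0.
  by have := le_lebesgue_outer dF; rewrite leNgt [ltLHS]Fm0 lebesgue_ball_gt0.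
Qed.
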